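(* Let $a\ge 3$ be an odd integer and let $S=\langle a,a+4\rangle$. Then, with $b$ denoting a non-negative integer satisfying the relevant condition, the largest perfect square ${}^{2}r(S)$ not belonging to $S$ is given by $$ {}^{2}r(S)=\begin{cases} (a-(4b-1))^2 & \text{if either } (4b+1)^2\le a+4<(4b+3)^2 \text{ and } a\equiv 1 \pmod 4,\\ & \text{or } (4b+1)^2\le 3(a+4)<(4b+3)^2 \text{ and } a\equiv 3 \pmod 4;\\[1ex] (a-(4b+1))^2 & \text{if either } (4b+3)^2\le a+4<(4b+5)^2 \text{ and } a\equiv 1 \pmod 4,\\ & \text{or } (4b+3)^2\le 3(a+4)<(4b+5)^2 \text{ and } a\equiv 3 \pmod 4. \end{cases} $$
   Context: $\langle s_1,s_2\rangle=\{x_1s_1+x_2s_2 : x_1,x_2 \text{ integers},\ x_1,x_2\ge 0\}$. For a numerical semigroup $S$ with $1\notin S$ (generated by relatively prime positive integers), ${}^{2}r(S)$ denotes the largest perfect square $m^2$ ($m\ge 1$ an integer) not belonging to $S$. *)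

(* Defs.v *)
From Stdlib Require Import ZArith.
Open Scope Z_scope.

Definition semigroup2 (s1 s2 : Z) (n : Z) : Prop :=
  exists x1 x2 : Z, 0 <= x1 /\ 0 <= x2 /\ n = x1 * s1 + x2 * s2.

Definition positive_square (n : Z) : Prop :=
  exists m : Z, 1 <= m /\ n = m ^ 2.

(* [is_r2 S N] states that the largest perfect square outside [S] exists and
   equals [N]; such an [N] is unique. *)
Definition is_r2 (S : Z -> Prop) (N : Z) : Prop :=
  (positive_square N /\ ~ S N) /\
  forall n : Z, positive_square n -> ~ S n -> n <= N.

Definition condition1 (a b : Z) : Prop :=
  ((4 * b + 1) ^ 2 <= a + 4 < (4 * b + 3) ^ 2 /\ a mod 4 = 1) \/
  ((4 * b + 1) ^ 2 <= 3 * (a + 4) < (4 * b + 3) ^ 2 /\ a mod 4 = 3).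

Definition condition2 (a b : Z) : Prop :=
  ((4 * b + 3) ^ 2 <= a + 4 < (4 * b + 5) ^ 2 /\ a mod 4 = 1) \/
  ((4 * b + 3) ^ 2 <= 3 * (a + 4) < (4 * b + 5) ^ 2 /\ a mod 4 = 3).

(* Main.v *)
Require Import Defs.
From Stdlib Require Import ZArith.
From Stdlib Require Import Lia Znumtheory.
Open Scope Z_scope.

(** Write a square as [(a - k)^2].  If it equals [x a + y (a + 4)], then
    [t = a - 2k - x - y] satisfies
<<
      4 y = k^2 + t a      and      4 x = (4 - t) (a + 4) - (k + 4)^2,
>>
    so membership asks for an integer [t], with [k^2 + t a] divisible by 4, that
    is neither too small (so that [y >= 0]) nor too large (so that [x >= 0]):
    this is [sub_square_mem_iff].

    Only the class of [t] modulo 4 matters for divisibility.  For even [k] one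
    can take [t = 0], and then the square is in the semigroup as soon as
    [(k + 4)^2 <= 4 (a + 4)].  For odd [k], let [q] in {1, 3} be the inverse of
    [a] modulo 4; then [t] is congruent to [- q], and [t = 4 - q] works when
    [(k + 4)^2 <= q (a + 4)].  So odd [k] is the tighter parity, and if [c] is
    the odd number with [c^2 <= q (a + 4) < (c + 2)^2], the first odd [k] that
    fails for [t = 4 - q] is [k = c - 2].  It fails for every other [t] too,
    because the next candidate [t = - q] needs [k^2 >= q a], whereas
    [(c - 2)^2 < q a].  All [k] from 0 to [c - 3] succeed, and squares
    beyond [a^2] exceed the Frobenius number [a^2 + 2 a - 4]; hence the largest
    missing square is [(a - (c - 2))^2] ([is_r2_of_odd_sqrt]).  The two
    conditions of the theorem are [c = 4b + 1] and [c = 4b + 3]. *)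

(** Sylvester's bound.  The coefficient of [s2] can be chosen in [[0, s1)], and
    then that of [s1] is greater than -1. *)
Lemma semigroup2_above_frobenius (s1 s2 n : Z) :
  0 < s1 -> 0 < s2 -> rel_prime s1 s2 -> s1 * s2 - s1 - s2 < n ->
  semigroup2 s1 s2 n.
Proof.
  intros h1 h2 hcop hn.
  destruct (rel_prime_bezout _ _ hcop) as [u v huv].
  pose proof (Z.div_mod (n * v) s1 ltac:(lia)) as hdiv.
  pose proof (Z.mod_pos_bound (n * v) s1 h1) as hy.
  set (y := (n * v) mod s1) in *. set (d := (n * v) / s1) in *.
  exists (n * u + d * s2), y.
  assert (heq : n = (n * u + d * s2) * s1 + y * s2).
  { transitivity (n * (u * s1 + v * s2)); [rewrite huv; ring|].
    transitivity (n * u * s1 + (n * v) * s2); [ring|].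
    rewrite hdiv; ring. }
  repeat split; [|lia|exact heq].
  assert (y * s2 <= (s1 - 1) * s2) by nia.
  nia.
Qed.

Lemma sub_square_mem_iff (a k : Z) :
  semigroup2 a (a + 4) ((a - k) ^ 2) <->
  exists t y : Z,
    4 * y = k ^ 2 + t * a /\ 0 <= y /\ (k + 4) ^ 2 <= (4 - t) * (a + 4).
Proof.
  split.
  - intros (x & y & hx & hy & heq).
    exists (a - 2 * k - x - y), y. repeat split; nia.
  - intros (t & y & hty & hy & ht).
    exists (a - 2 * k - t - y), y. repeat split; nia.
Qed.

(** The bound is the one given by [t = 0]. *)
Lemma even_sub_square_mem (a k : Z) :
  Z.Even k -> (k + 4) ^ 2 <= 4 * (a + 4) ->
  semigroup2 a (a + 4) ((a - k) ^ 2).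
Proof.
  intros [i ->] hk. apply sub_square_mem_iff.
  exists 0, (i ^ 2). repeat split; nia.
Qed.

(** The bound is the one given by [t = 4 - q], a solution of
    [k^2 + t a = 0] modulo 4 since [k^2] and [q a] are both 1 modulo 4. *)
Lemma odd_sub_square_mem (a k q j : Z) :
  0 <= a -> q <= 4 -> q * a = 4 * j + 1 -> Z.Odd k ->
  (k + 4) ^ 2 <= q * (a + 4) ->
  semigroup2 a (a + 4) ((a - k) ^ 2).
Proof.
  intros ha hq hqa [i ->] hk. apply sub_square_mem_iff.
  exists (4 - q), (i ^ 2 + i + a - j). repeat split; nia.
Qed.

(** An admissible [t] is [4 - q + 4 z]: the first bound excludes [z < 0]
    and the second one [z >= 0]. *)
Lemma odd_sub_square_not_mem (a k q j : Z) :
  0 <= a -> q * a = 4 * j + 1 -> Z.Odd k ->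
  k ^ 2 < q * a -> q * (a + 4) < (k + 4) ^ 2 ->
  ~ semigroup2 a (a + 4) ((a - k) ^ 2).
Proof.
  intros ha hqa [i hi] hlow hhigh hmem.
  apply sub_square_mem_iff in hmem as (t & y & hty & hy & ht).
  assert (hz : exists z, t = 4 - q + 4 * z).
  { (* Multiplying [t a = -1] (mod 4) by [q] gives [t = -q] (mod 4). *)
    exists (q * y - q * (i ^ 2 + i) - j * t - 1).
    assert (q * (4 * y) = q * k ^ 2 + t * (q * a)) by (rewrite hty; ring).
    rewrite hqa in *. subst k. lia. }
  destruct hz as [z hz].
  destruct (Z_lt_le_dec z 0) as [hneg | hpos].
  - assert (t * a <= - q * a) by (apply Z.mul_le_mono_nonneg_r; lia). lia.
  - assert ((4 - t) * (a + 4) <= q * (a + 4))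
      by (apply Z.mul_le_mono_nonneg_r; lia). lia.
Qed.

Lemma is_r2_of_odd_sqrt (a q j c : Z) :
  3 <= a -> q = 1 \/ q = 3 -> q * a = 4 * j + 1 ->
  0 < c -> Z.Odd c -> c ^ 2 <= q * (a + 4) < (c + 2) ^ 2 ->
  is_r2 (semigroup2 a (a + 4)) ((a - (c - 2)) ^ 2).
Proof.
  intros ha hq hqa hc hodd [hlow hhigh].
  (* [c = 1] would force [q (a + 4) < 9], so [q = 1] and [a < 5], which the
     congruence excludes. *)
  assert (hc3 : 3 <= c).
  { destruct hodd as [e ->].
    destruct (Z.eq_dec e 0) as [-> | he]; [exfalso|]; lia. }
  assert (hca : c <= a + 1) by (destruct hq as [-> | ->]; nia).
  split; [split|].
  - exists (a - (c - 2)). split; [lia | reflexivity].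
  - apply odd_sub_square_not_mem with (q := q) (j := j).
    + lia.
    + exact hqa.
    + destruct hodd as [e ->]. exists (e - 1). lia.
    + (* [c^2 <= q a + 4 q] suffices when [c > q + 1]; the exception is
         [c = 3], [q = 3]. *)
      destruct (Z.eq_dec c 3) as [-> | hne]; [destruct hq; subst q; lia|].
      destruct hq as [-> | ->]; destruct hodd as [e ->]; nia.
    + replace (c - 2 + 4) with (c + 2) by ring. exact hhigh.
  - intros n (m & hm & ->) hnot.
    destruct (Z_le_gt_dec m (a - (c - 2))) as [hle | hgt]; [nia|].
    exfalso. apply hnot.
    destruct (Z_lt_le_dec a m) as [hbig | hsmall].
    + apply semigroup2_above_frobenius; try lia.
      * (* [4 = (a + 4) - a], so [q a - 4 j = 1] is a Bezout relation. *)
        apply bezout_rel_prime, (Bezout_intro _ _ _ (q + j) (- j)). lia.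
      * nia.
    + replace m with (a - (a - m)) by ring.
      set (k := a - m). assert (hk : 0 <= k <= c - 3) by lia.
      destruct (Z.Even_or_Odd k) as [heven | hkodd].
      * apply even_sub_square_mem; [exact heven|].
        (* [(c + 1)^2 <= 4 (a + 4)] follows from [c^2 <= 3 (a + 4)] by
           convexity once [c >= 7]; the odd values 3 and 5 use the size
           of [a]. *)
        assert ((k + 4) ^ 2 <= (c + 1) ^ 2) by (apply Z.pow_le_mono_l; lia).
        assert (c = 3 \/ c = 5 \/ 7 <= c)
          by (destruct hodd as [e ->]; lia).
        assert (c ^ 2 <= 3 * (a + 4)) by (destruct hq; subst q; lia).
        enough ((c + 1) ^ 2 <= 4 * (a + 4)) by lia.
        assert (c = 3 \/ c = 5 \/ 3 * (c + 1) ^ 2 <= 4 * c ^ 2) by nia.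
        destruct hq; subst q; lia.
      * apply (odd_sub_square_mem a k q j ltac:(lia) ltac:(lia) hqa hkodd).
        assert (k + 4 <= c)
          by (destruct hodd as [e ->], hkodd as [i hi]; lia).
        assert ((k + 4) ^ 2 <= c ^ 2) by (apply Z.pow_le_mono_l; lia).
        lia.
Qed.

Lemma odd_square_bracket (n : Z) :
  1 <= n ->
  exists b : Z, 0 <= b /\
    ((4 * b + 1) ^ 2 <= n < (4 * b + 3) ^ 2 \/
     (4 * b + 3) ^ 2 <= n < (4 * b + 5) ^ 2).
Proof.
  intros hn.
  pose proof (Z.sqrt_spec n ltac:(lia)) as hs; cbv zeta in hs.
  assert (hs1 : 1 <= Z.sqrt n) by (apply Z.sqrt_le_square; lia).
  remember (Z.sqrt n) as s eqn:hsdef. clear hsdef.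
  pose proof (Z.div_mod (s - 1) 4 ltac:(lia)) as hdiv.
  pose proof (Z.mod_pos_bound (s - 1) 4 ltac:(lia)) as hr.
  remember ((s - 1) / 4) as b eqn:hbdef. clear hbdef.
  remember ((s - 1) mod 4) as r eqn:hrdef. clear hrdef.
  exists b. assert (hb : 0 <= b) by lia. split; [exact hb|].
  assert (s = 4 * b + 1 \/ s = 4 * b + 2 \/ s = 4 * b + 3 \/ s = 4 * b + 4)
    as hcases by lia.
  destruct hcases as [e | [e | [e | e]]]; rewrite e in hs;
    [left | left | right | right]; lia.
Qed.

Theorem theorem3p2 (a : Z) (ha : 3 <= a) (hodd : Z.Odd a) :
  (exists b : Z, 0 <= b /\ (condition1 a b \/ condition2 a b)) /\
  (forall b : Z, 0 <= b ->
     (condition1 a b -> is_r2 (semigroup2 a (a + 4)) ((a - (4 * b - 1)) ^ 2)) /\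
     (condition2 a b -> is_r2 (semigroup2 a (a + 4)) ((a - (4 * b + 1)) ^ 2))).
Proof.
  pose proof (Z.div_mod a 4 ltac:(lia)) as hdiv.
  split.
  - assert (hmod : a mod 4 = 1 \/ a mod 4 = 3).
    { pose proof (Z.mod_pos_bound a 4 ltac:(lia)).
      destruct hodd as [i hi]. lia. }
    unfold condition1, condition2.
    destruct hmod.
    + destruct (odd_square_bracket (a + 4) ltac:(lia)) as (b & hb & hbr).
      exists b. tauto.
    + destruct (odd_square_bracket (3 * (a + 4)) ltac:(lia)) as (b & hb & hbr).
      exists b. tauto.
  - intros b hb. split.
    + replace (4 * b - 1) with (4 * b + 1 - 2) by ring.
      intros [[hbr hmod] | [hbr hmod]].
      * apply is_r2_of_odd_sqrt with (q := 1) (j := a / 4);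
          try lia.
        exists (2 * b). ring.
      * apply is_r2_of_odd_sqrt with (q := 3) (j := 3 * (a / 4) + 2);
          try lia.
        exists (2 * b). ring.
    + replace (4 * b + 1) with (4 * b + 3 - 2) by ring.
      intros [[hbr hmod] | [hbr hmod]].
      * apply is_r2_of_odd_sqrt with (q := 1) (j := a / 4); try lia.
        exists (2 * b + 1). ring.
      * apply is_r2_of_odd_sqrt with (q := 3) (j := 3 * (a / 4) + 2); try lia.
        exists (2 * b + 1). ring.
Qed.
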